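(* Let $G$ be a simple connected graph with $N_0^k$ vertices and $E_0^k\ge1$ edges, and let $k\ge2$, $n\ge1$ be integers. The multiplicative degree-Kirchhoff indices of the $k$-hexagonal graphs $H^k_n(G)$ and $H^k_{n-1}(G)$ satisfy $$\begin{aligned}Kf'(H^k_n(G))={}&\frac{5(5k+1)^2}{k+5}Kf'(H^k_{n-1}(G))-\frac{16k(5k+1)^n}{k+5}E_0^kN_0^k\\&+\left[\frac{64k}{5(k+5)}(5k+1)^n+\frac{16k(5k+21)}{5(k+5)}(5k+1)^{2n-1}\right](E_0^k)^2+\frac{8(5k^2-23k)}{k+5}(5k+1)^{n-1}E_0^k.\end{aligned}$$ The general expression is $$\begin{aligned}Kf'(H^k_n(G))={}&\left[\frac{5(5k+1)^2}{k+5}\right]^nKf'(G)-\frac{16k(5k+1)^n\mu}{k+5}E_0^kN_0^k\\&+\left[\frac{64k\mu}{5(k+5)}(5k+1)^n+\frac{16k(5k+21)\eta}{5(k+5)}(5k+1)^{2n-1}\right](E_0^k)^2+\frac{8(5k^2-23k)\mu}{k+5}(5k+1)^{n-1}E_0^k,\end{aligned}$$ where $$\mu=\frac{k+5}{24k}\left\{\left[\frac{5(5k+1)}{k+5}\right]^n-1\right\},\qquad \eta=-\frac{k+5}{k}\left\{\left[\frac5{k+5}\right]^n-1\right\}.$$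
   Context: Graphs are finite, simple and connected. The superscript $k$ in $N_0^k$, $E_0^k$ is an index, not a power: these are simply the order and size of $H^k_0(G)=G$. The $k$-hexagonal graph $H^k(G)$ of $G$ is obtained by replacing each edge $uv$ of $G$ by $k+1$ internally disjoint $u$–$v$ paths, one of length $1$ (the edge $uv$ itself) and $k$ of length $5$ (each with 4 new internal vertices). Set $H^k_0(G)=G$ and $H^k_n(G)=H^k(H^k_{n-1}(G))$ for $n\ge1$. The multiplicative degree-Kirchhoff index of a connected graph $F$ is $Kf'(F)=\sum_{v<u}d_vd_ur_{vu}$, the sum over unordered pairs of distinct vertices, where $d_v$ is the degree of $v$ and $r_{vu}$ is the resistance distance between $v$ and $u$ (the effective resistance when every edge is a unit resistor). *)

(* Defs.v *)
From HB Require Import structures.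
From mathcomp Require Import all_boot all_order all_algebra.
From mathcomp Require Import lra.

Set Implicit Arguments.
Unset Strict Implicit.
Unset Printing Implicit Defensive.

Import Order.TTheory GRing.Theory Num.Theory.
Local Open Scope ring_scope.

Record sgraph := SGraph {
  vertex :> finType;
  adj : rel vertex;
  adj_sym : symmetric adj;
  adj_irrefl : irreflexive adj }.

Definition connected (G : sgraph) : Prop :=
  forall u v : G, connect (@adj G) u v.

Definition edges (G : sgraph) : {set {set G}} :=
  [set [set p.1; p.2] | p in [pred p : G * G | adj p.1 p.2]].

Definition deg (G : sgraph) (v : G) : nat := #|[set w | adj v w]|.

(* An edge uv is represented by its two darts (u, v) and (v, u). *)
Definition dart (G : sgraph) : finType := {p : G * G | adj p.1 p.2}.

Lemma drev_subproof (G : sgraph) (d : dart G) :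
  adj (val d).2 (val d).1.
Proof. by rewrite adj_sym (valP d). Qed.

Definition drev (G : sgraph) (d : dart G) : dart G :=
  exist (fun p : G * G => adj p.1 p.2) ((val d).2, (val d).1)
    (drev_subproof d).

Lemma drevK (G : sgraph) : involutive (@drev G).
Proof. by move=> d; apply: val_inj; case: d => -[]. Qed.

Lemma drev_neq (G : sgraph) (d : dart G) : drev d != d.
Proof.
apply/eqP=> /(congr1 val) /=; case: d => -[u v] /= uv [vu _].
by move: uv; rewrite vu adj_irrefl.
Qed.

(* Writing d = (u, v) and d' = (v, u), the i-th new u-v path is
     u -- (d, i, false) -- (d, i, true) -- (d', i, true) -- (d', i, false) -- v,
   so that no orientation of the edges has to be chosen. *)
Section Hexagonal.
Variables (k : nat) (G : sgraph).

Definition hex_vertex : finType := (G + dart G * 'I_k * bool)%type.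

Definition hex_adj (x y : hex_vertex) : bool :=
  match x, y with
  | inl u, inl v => adj u v
  | inl u, inr (d, _, b) | inr (d, _, b), inl u => ~~ b && (u == (val d).1)
  | inr (d, i, b), inr (d', i', b') =>
      (i == i') &&
      ((d == d') && (b != b') || (d' == drev d) && b && b')
  end.

Lemma hex_adj_sym : symmetric hex_adj.
Proof.
move=> [u|[[d i] b]] [v|[[d' i'] b']] //=; first exact: adj_sym.
have -> : (d' == drev d) = (d == drev d').
  by rewrite -(inv_eq (@drevK G)) eq_sym.
by rewrite [i == _]eq_sym [d == d']eq_sym [b == _]eq_sym -!andbA [b && _]andbC.
Qed.

Lemma hex_adj_irrefl : irreflexive hex_adj.
Proof.
move=> [u|[[d i] b]] /=; first exact: adj_irrefl.
by rewrite !eqxx /= eq_sym (negbTE (drev_neq d)).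
Qed.

Definition hex : sgraph := SGraph hex_adj_sym hex_adj_irrefl.

End Hexagonal.

Definition hexn (k n : nat) (G : sgraph) : sgraph := iter n (hex k) G.

Section Resistance.
Variables (R : realFieldType) (G : sgraph).

Definition laplacian : 'M[R]_#|G| :=
  \matrix_(i, j) ((deg (enum_val i))%:R *+ (i == j)
                  - (adj (enum_val i) (enum_val j))%:R).

Definition unit_current (u v : G) : 'rV[R]_#|G| :=
  \row_i ((enum_val i == u)%:R - (enum_val i == v)%:R).

(* The electric potential when a unit current enters at u and leaves at v,
   every edge being a unit resistor; pinvmx picks one of the solutions of
   Kirchhoff's equations, which differ by constants (see potential_kirchhoff
   and resistance_unique). *)
Definition potential (u v : G) : G -> R :=
  fun w => (unit_current u v *m pinvmx laplacian) 0 (enum_rank w).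

Definition resistance (u v : G) : R := potential u v u - potential u v v.

Definition kirchhoff (u v : G) (f : G -> R) : Prop :=
  forall w, \sum_(z | adj w z) (f w - f z) = (w == u)%:R - (w == v)%:R.

Lemma laplacian_sym : laplacian^T = laplacian.
Proof.
apply/matrixP=> i j; rewrite !mxE adj_sym; congr (_ - _).
by rewrite eq_sym; case: eqP => [->|].
Qed.

Lemma laplacianE (f : G -> R) i :
  (laplacian *m \col_j f (enum_val j)) i 0
  = \sum_(z | adj (enum_val i) z) (f (enum_val i) - f z).
Proof.
rewrite mxE sumrB sumr_const.
under eq_bigr do rewrite !mxE mulrBl.
rewrite sumrB (bigD1 i) //= eqxx mulr1n big1 ?addr0; last first.
  by move=> j /negbTE ji; rewrite eq_sym ji mul0r.
congr (_ - _).
  by rewrite mulr_natl /deg; congr (_ *+ _); apply: eq_card => z; rewrite inE.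
rewrite [RHS]big_mkcond /= [RHS](reindex (@enum_val G G)) /=;
  last exact/onW_bij/enum_val_bij.
by apply: eq_bigr => j _; case: (adj _ _); rewrite ?mul1r ?mul0r.
Qed.

Lemma harmonic_const (f : G -> R) : connected G ->
  (forall w, \sum_(z | adj w z) (f w - f z) = 0) -> forall u v, f u = f v.
Proof.
move=> cG hf.
have hE : \sum_w \sum_(z | adj w z) (f w - f z) ^+ 2 = 0.
  have e1 : \sum_w \sum_(z | adj w z) f w * (f w - f z) = 0.
    by apply: big1 => w _; rewrite -mulr_sumr hf mulr0.
  have e2 : \sum_w \sum_(z | adj w z) f z * (f w - f z) = 0.
    rewrite (exchange_big_dep predT) //=; apply: big1 => z _.
    rewrite -mulr_sumr (eq_big (adj z) (fun w => - (f z - f w))).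
    - by rewrite sumrN hf oppr0 mulr0.
    - by move=> w; rewrite adj_sym.
    - by move=> w _; rewrite opprB.
  rewrite (eq_bigr (fun w => \sum_(z | adj w z) f w * (f w - f z)
                           - \sum_(z | adj w z) f z * (f w - f z))).
    by rewrite sumrB e1 e2 subrr.
  by move=> w _; rewrite -sumrB; apply: eq_bigr => z _; rewrite expr2 mulrBl.
have step u v : adj u v -> f u = f v.
  move=> uv.
  have h1 := psumr_eq0P (fun w _ => sumr_ge0 _ (fun z _ => sqr_ge0 (f w - f z))) hE.
  have /eqP := psumr_eq0P (fun z _ => sqr_ge0 (f u - f z)) (h1 u isT) uv.
  by rewrite sqrf_eq0 subr_eq0 => /eqP.
move=> u v; have /connectP[p pth ->] := cG u v.
elim: p u pth => [//|x p IH] u /= /andP[ux /IH <-].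
exact: step.
Qed.

Lemma kirchhoffE u v (f : G -> R) :
  (\row_j f (enum_val j)) *m laplacian = unit_current u v <-> kirchhoff u v f.
Proof.
have key : ((\row_j f (enum_val j)) *m laplacian)^T
    = laplacian *m \col_j f (enum_val j).
  by rewrite trmx_mul laplacian_sym; congr (_ *m _); apply/matrixP=> i j; rewrite !mxE.
split=> [h w|h].
  have /matrixP/(_ (enum_rank w) 0) := congr1 trmx h.
  by rewrite key laplacianE !mxE enum_rankK.
apply: trmx_inj; rewrite key; apply/matrixP=> i j.
by rewrite ord1 laplacianE h !mxE.
Qed.

Lemma potential_kirchhoff u v : connected G -> kirchhoff u v (potential u v).
Proof.
move=> cG; apply/kirchhoffE.
have -> : \row_j potential u v (enum_val j) = unit_current u v *m pinvmx laplacian.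
  by apply/rowP=> j; rewrite mxE /potential enum_valK.
apply: mulmxKpV; rewrite submxE; apply/eqP; apply/matrixP=> a j; rewrite ord1 [RHS]mxE {a}.
pose g (w : G) := cokermx laplacian (enum_rank w) j.
have gc : forall a b, g a = g b.
  apply: harmonic_const => // w.
  have := laplacianE g (enum_rank w); rewrite enum_rankK => <-.
  have := congr1 (fun M : 'M_#|G| => M (enum_rank w) j) (mulmx_coker laplacian).
  rewrite !mxE => {2}<-; apply: eq_bigr => i _.
  by congr (_ * _); rewrite mxE /g enum_valK.
rewrite mxE (eq_bigr (fun i => unit_current u v 0 i * g u)); last first.
  by move=> i _; congr (_ * _); rewrite (gc u (enum_val i)) /g enum_valK.
rewrite -mulr_suml.
suff -> : \sum_i unit_current u v 0 i = 0 by rewrite mul0r.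
have -> : \sum_i unit_current u v 0 i = \sum_w ((w == u)%:R - (w == v)%:R).
  rewrite [RHS](reindex (@enum_val G G)) /=; last exact/onW_bij/enum_val_bij.
  by apply: eq_bigr => i _; rewrite mxE.
have s1 (x : G) : \sum_w (w == x)%:R = 1 :> R.
  by rewrite (bigD1 x) //= eqxx big1 ?addr0 // => w /negbTE ->.
by rewrite sumrB !s1 subrr.
Qed.

Lemma resistance_unique u v (f : G -> R) :
  connected G -> kirchhoff u v f -> resistance u v = f u - f v.
Proof.
move=> cG hf; have hp := potential_kirchhoff u v cG.
have h : potential u v u - f u = potential u v v - f v.
  apply: (@harmonic_const (fun w => potential u v w - f w)) => // w.
  rewrite (eq_bigr (fun z => (potential u v w - potential u v z) - (f w - f z))).
    by rewrite sumrB hp hf subrr.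
  by move=> z _; rewrite !opprB addrACA [RHS]addrACA; congr (_ + _); rewrite addrC.
by rewrite /resistance; lra.
Qed.

(* The enumeration order enum_rank selects one ordered pair from each
   unordered pair of distinct vertices. *)
Definition mult_degree_Kirchhoff : R :=
  \sum_(p : G * G | (enum_rank p.1 < enum_rank p.2)%N)
    (deg p.1)%:R * (deg p.2)%:R * resistance p.1 p.2.

End Resistance.

(* Main.v *)
Require Import Defs.
From mathcomp Require Import all_boot all_order all_algebra.
From mathcomp Require Import ring lra.

Set Implicit Arguments.
Unset Strict Implicit.
Unset Printing Implicit Defensive.

Import Order.TTheory GRing.Theory Num.Theory.
Local Open Scope ring_scope.

(** Let G have N vertices and E edges, let H be its k-hexagonal graph and
    q = 5k + 1.  Everything rests on a Green kernel g of G: a function of two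
    vertices whose column at b is the potential of a unit current from b to a
    fixed root.  Since r(u,v) = g(u,u) - g(u,v) - g(v,u) + g(v,v), the
    multiplicative degree-Kirchhoff index is 2E tr - tot, where tr and tot are
    the degree-weighted sums of g over the diagonal and over all pairs
    ([mult_degree_Kirchhoff_green]).

    A Green kernel of H is obtained from one of G ([hex_greenP]).  A function
    on G extends linearly along the paths to a function on H ([interp]); the
    extension is harmonic at the new vertices, and at the old ones its
    Laplacian is (k+5)/5 times that on G, because an edge in parallel with k
    paths of five edges has conductance 1 + k/5.  Extending g in both
    arguments and multiplying by 5/(k+5) thus gives the right Laplacian at old
    vertices, and the Green function of each path with both ends grounded
    ([path_green]) corrects it at the new ones.

    Summing over H is then local.  The degree-weighted sum of an interpolated
    function is q times that on G ([sum_deg_interp]), as the path vertices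
    hand their weight back to the ends.  On the diagonal, interpolating in
    both arguments at once differs from interpolating the diagonal by
    multiples of the resistances across the edges of G, and by Foster's
    theorem ([foster]) these resistances add up to N - 1.  The path part is the
    same for every edge: it adds 8kE to tr and 40kE to tot.  The result is the
    one-step formula [mult_degree_Kirchhoff_hex]:
      Kf'(H) = 5 q^2/(k+5) Kf'(G) - 16 k q/(k+5) E (N - 1)
               + 16 k q E^2 - 40 k E.

    Along the iteration E is multiplied by q and N grows by 4kE, so the index
    obeys an affine recurrence whose inhomogeneous terms are multiples of q^m
    and q^(2m); its solution brings in the two geometric sums mu and eta. *)

(** * Sums over darts and the handshake lemma *)

Section DartSums.
Variables (R : realFieldType) (G : sgraph).

Lemma sum_dart (F : G -> G -> R) :
  \sum_(d : dart G) F (val d).1 (val d).2 = \sum_u \sum_(v | adj u v) F u v.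
Proof.
rewrite pair_big_dep /=.
by rewrite -(big_sub (fun p : G * G => adj p.1 p.2) (fun p => F p.1 p.2)).
Qed.

Lemma sum_dart_from (a : G) (F : G -> R) :
  \sum_(d : dart G | a == (val d).1) F (val d).2 = \sum_(v | adj a v) F v.
Proof.
rewrite big_mkcond (sum_dart (fun u v => if a == u then F v else 0)).
rewrite (bigD1 a) //= [X in _ + X]big1 ?addr0; last first.
  by move=> u /negbTE ua; apply: big1 => v _; rewrite eq_sym ua.
by apply: eq_bigr => v _; rewrite eqxx.
Qed.

Lemma sum_dart_rev (F : dart G -> R) : \sum_d F (drev d) = \sum_d F d.
Proof. by rewrite [RHS](reindex_inj (inv_inj (@drevK G))). Qed.

Lemma sum_adj (u : G) (c : R) : \sum_(v | adj u v) c = (deg u)%:R * c.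
Proof.
rewrite sumr_const mulr_natl /deg; congr (_ *+ _).
by apply: eq_card => v; rewrite inE.
Qed.

Lemma sum_deg_dart (F : G -> R) :
  \sum_u (deg u)%:R * F u = \sum_(d : dart G) F (val d).1.
Proof.
rewrite (sum_dart (fun u _ => F u)).
by apply: eq_bigr => u _; rewrite sum_adj.
Qed.

Lemma card_dart : #|{: dart G}| = (#|edges G| * 2)%N.
Proof.
have -> : #|{: dart G}| = #|[set p : G * G | adj p.1 p.2]|.
  by rewrite card_sub; apply: eq_card => p; rewrite !inE.
rewrite -sum1_card (partition_big_imset (fun p : G * G => [set p.1; p.2])).
have -> : [set [set p.1; p.2] | p : G * G in [set p : G * G | adj p.1 p.2]]
    = edges G.
  apply/setP=> A; apply/imsetP/imsetP => -[p]; rewrite inE => pp ->;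
  by exists p; rewrite ?inE.
rewrite -sum_nat_const; apply: eq_bigr => A /imsetP[[u v]]; rewrite inE /= => uv ->.
have nuv : (u, v) != (v, u).
  by apply/eqP=> -[vu _]; move: uv; rewrite vu adj_irrefl.
(* The fibre over the edge {u, v} consists of the two darts (u, v), (v, u). *)
rewrite sum1dep_card -[RHS](_ : #|[set (u, v); (v, u)]| = 2); last by rewrite cards2 nuv.
apply: eq_card => -[a b]; rewrite !inE /= !xpair_eqE.
apply/andP/orP => [[ab /eqP/setP abuv]|].
  have := abuv a; have := abuv b; rewrite !inE !eqxx orbT /=.
  case/esym/orP=> /eqP bE; case/esym/orP=> /eqP aE; subst; rewrite ?eqxx.
  - by rewrite adj_irrefl in ab.
  - by right.
  - by left.
  - by rewrite adj_irrefl in ab.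
by case=> /andP[/eqP-> /eqP->]; rewrite ?uv // adj_sym uv setUC.
Qed.

Lemma sum_deg : \sum_(u : G) (deg u)%:R = 2 * #|edges G|%:R :> R.
Proof.
rewrite -[LHS](_ : \sum_(u : G) (deg u)%:R * 1 = _); last first.
  by apply: eq_bigr => u _; rewrite mulr1.
by rewrite (sum_deg_dart (fun=> 1)) sumr_const card_dart mulrC -natrM.
Qed.

End DartSums.

(** * Green kernels, the degree-Kirchhoff index and Foster's theorem *)

Section Kernel.
Variables (R : realFieldType) (G : sgraph).

(** Only the Laplacian in the first argument is prescribed: each column is
    fixed up to its own additive constant, and no symmetry is imposed.  This
    is enough for resistances, and makes a kernel easy to transport. *)
Definition green_kernel (o : G) (g : G -> G -> R) : Prop :=
  forall b, kirchhoff b o (g^~ b).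

Lemma green_kernel_exists (o : G) : connected G -> exists g, green_kernel o g.
Proof.
move=> cG; exists (fun a b => potential R b o a) => b.
exact: potential_kirchhoff.
Qed.

Variables (o : G) (g : G -> G -> R).
Hypothesis gP : green_kernel o g.

(** The difference of columns u and v is a potential for a unit current from
    u to v, since the currents extracted at the root cancel. *)
Lemma resistance_green (u v : G) : connected G ->
  resistance R u v = g u u - g u v - g v u + g v v.
Proof.
move=> cG; rewrite (@resistance_unique _ _ _ _ (fun w => g w u - g w v)) //.
  by ring.
move=> w; have hu := gP u w; have hv := gP v w.
rewrite (eq_bigr (fun z => (g w u - g z u) - (g w v - g z v))); last first.
  by move=> z _; ring.
by rewrite sumrB hu hv; ring.
Qed.

(** Twice the index is the sum over all ordered pairs, resistance being
    symmetric and zero on the diagonal; expanding the resistances gives the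
    two sums on the right, with 2E the sum of the degrees. *)
Lemma mult_degree_Kirchhoff_green : connected G ->
  mult_degree_Kirchhoff R G =
    2 * #|edges G|%:R * (\sum_u (deg u)%:R * g u u)
    - \sum_u (deg u)%:R * \sum_v (deg v)%:R * g u v.
Proof.
move=> cG; rewrite /mult_degree_Kirchhoff.
pose F (p : G * G) : R := (deg p.1)%:R * (deg p.2)%:R * resistance R p.1 p.2.
pose rk := @enum_rank G.
have Fsym u v : F (u, v) = F (v, u).
  by rewrite /F /= !resistance_green //; ring.
have half : \sum_p F p = \sum_(p | (rk p.1 < rk p.2)%N) F p *+ 2.
  rewrite (bigID (fun p : G * G => (rk p.1 < rk p.2)%N)) /= sumrMnl mulr2n.
  rewrite [X in _ + X](bigID (fun p : G * G => (rk p.2 < rk p.1)%N)) /=.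
  rewrite [X in _ + (_ + X)]big1 ?addr0; last first.
    case=> u v /=; rewrite -!leqNgt => /andP[vu uv].
    have -> : u = v.
      by apply: enum_rank_inj; apply: val_inj; apply/eqP; rewrite eqn_leq uv.
    by rewrite /F /= resistance_green //; ring.
  have -> : \sum_(p : G * G | ~~ (rk p.1 < rk p.2)%N && (rk p.2 < rk p.1)%N) F p
     = \sum_(p : G * G | (rk p.1 < rk p.2)%N) F p.
    rewrite [RHS](reindex_inj (can_inj (@swap_pairK G G))) /=.
    apply: eq_big => [[u v]|[u v] _] /=; last exact: Fsym.
    by rewrite -leqNgt andb_idl // => /ltnW.
  by [].
apply: (@mulIf _ 2); first by rewrite pnatr_eq0.
rewrite mulr_natr -sumrMnl -half /F.
rewrite -(pair_bigA _
  (fun u v => (deg u)%:R * (deg v)%:R * resistance R u v)) /=.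
have E u : \sum_v (deg u)%:R * (deg v)%:R * resistance R u v
  = (2 * #|edges G|%:R) * ((deg u)%:R * g u u)
    - (deg u)%:R * (\sum_v (deg v)%:R * g u v)
    - (\sum_v (deg v)%:R * ((deg u)%:R * g v u))
    + (deg u)%:R * \sum_v (deg v)%:R * g v v.
  rewrite -sum_deg mulr_suml !mulr_sumr -!sumrB -big_split /=.
  by apply: eq_bigr => v _; rewrite resistance_green //; ring.
rewrite (eq_bigr _ (fun u _ => E u)) big_split /= !sumrB -mulr_suml -mulr_sumr.
rewrite sum_deg exchange_big /=.
rewrite [X in _ - X + _](eq_bigr (fun u => (deg u)%:R * \sum_v (deg v)%:R * g u v)).
  by ring.
by move=> u _; rewrite mulr_sumr.
Qed.

(** Foster's theorem, each edge counted once per dart: at the dart (u, v) the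
    resistance is the flow on it of the current injected at u plus the flow on
    the reversed dart of the current injected at v.  At each u the flows out
    of u add up to 1, except at the root, where they vanish. *)
Lemma foster : connected G ->
  \sum_(d : dart G) resistance R (val d).1 (val d).2 = 2 * (#|G|%:R - 1).
Proof.
move=> cG.
pose F u v := g u u - g v u.
have E (d : dart G) : resistance R (val d).1 (val d).2
  = F (val d).1 (val d).2 + F (val (drev d)).1 (val (drev d)).2.
  by rewrite resistance_green //= /F; ring.
rewrite (eq_bigr _ (fun d _ => E d)) big_split /=.
rewrite (sum_dart_rev (fun d => F (val d).1 (val d).2)) sum_dart.
rewrite (eq_bigr (fun u => 1 - (u == o)%:R)); last first.
  by move=> u _; rewrite /F (gP u u) eqxx.
rewrite sumrB sumr_const (bigD1 o) //= eqxx big1 ?addr0; last by move=> u /negbTE ->.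
by rewrite -mulr2n -[LHS]mulr_natl; congr (_ * (_%:R - _)).
Qed.

End Kernel.

(** * Neighbours, degrees and connectedness of the hexagonal graph *)

Section Hex.
Variables (R : realFieldType) (k : nat) (G : sgraph).
Local Notation K := (k%:R : R).
Local Notation H := (hex k G).
Implicit Types (f h : G -> R) (x y : H) (d : dart G) (i : 'I_k) (b : bool).

Lemma inr_eq (p q : dart G * 'I_k * bool) : (inr p == inr q :> H) = (p == q).
Proof. by []. Qed.

Lemma inl_eq (u v : G) : (inl u == inl v :> H) = (u == v).
Proof. by []. Qed.

Lemma sum_ord_const (c : R) : \sum_(i < k) c = K * c.
Proof. by rewrite sumr_const card_ord mulr_natl. Qed.

Lemma sum_hex (F : H -> R) :
  \sum_x F x = \sum_u F (inl u)
    + \sum_d \sum_i (F (inr (d, i, false)) + F (inr (d, i, true))).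
Proof.
rewrite big_sumType /=; congr (_ + _).
rewrite (eq_bigr (fun p => F (inr (p.1.1, p.1.2, p.2)))); last by move=> [[]].
rewrite -(pair_bigA _ (fun (q : dart G * 'I_k) b => F (inr (q.1, q.2, b)))) /=.
rewrite -(pair_bigA _ (fun d i => \sum_b F (inr (d, i, b)))) /=.
by apply: eq_bigr => d _; apply: eq_bigr => i _; rewrite big_bool addrC.
Qed.

Lemma sum_adj_old (a : G) (F : H -> R) :
  \sum_(z | @adj H (inl a) z) F z
  = \sum_(v | adj a v) F (inl v)
    + \sum_(d | a == (val d).1) \sum_i F (inr (d, i, false)).
Proof.
rewrite big_mkcond sum_hex /= -big_mkcond /=; congr (_ + _).
rewrite [RHS]big_mkcond /=; apply: eq_bigr => d _.
case: (a == _); last by apply: big1 => i _; rewrite addr0.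
by apply: eq_bigr => i _; rewrite addr0.
Qed.

Lemma sum_adj_new d i b (F : H -> R) :
  \sum_(z | @adj H (inr (d, i, b)) z) F z
  = F (inr (d, i, ~~ b))
    + (if b then F (inr (drev d, i, true)) else F (inl (val d).1)).
Proof.
case: b.
- rewrite (bigD1 (inr (d, i, false))) /=; last by rewrite !eqxx.
  rewrite (bigD1 (inr (drev d, i, true))) /=; last first.
    by rewrite inr_eq xpair_eqE !eqxx !andbF orbT.
  rewrite big1 ?addr0 // => -[u|[[d' i'] b']] /=; first by [].
  rewrite !inr_eq !xpair_eqE [d == d']eq_sym [i == i']eq_sym.
  by case: (d' == d); case: (i' == i); case: (d' == _); case: b'.
- rewrite (bigD1 (inr (d, i, true))) /=; last by rewrite !eqxx.
  rewrite (bigD1 (inl (val d).1)) /=; last by rewrite eqxx.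
  rewrite big1 ?addr0 // => -[u|[[d' i'] b']] /=.
    by rewrite inl_eq; case: (u == _).
  rewrite !inr_eq !xpair_eqE [d == d']eq_sym [i == i']eq_sym andbF /=.
  by case: (d' == d); case: (i' == i); case: b'.
Qed.

Lemma deg_hex_old (a : G) : (@deg H (inl a))%:R = (K + 1) * (deg a)%:R :> R.
Proof.
rewrite -[LHS]mulr1 -sum_adj sum_adj_old sum_adj.
under [X in _ + X]eq_bigr do rewrite sum_ord_const.
by rewrite (sum_dart_from a (fun=> K * 1)) sum_adj; ring.
Qed.

Lemma deg_hex_new d i b : (@deg H (inr (d, i, b)))%:R = 2 :> R.
Proof.
by rewrite -[LHS]mulr1 -sum_adj (sum_adj_new _ _ _ (fun=> 1)); case: b.
Qed.

Lemma connected_hex : connected G -> connected H.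
Proof.
have sH : connect_sym (@adj H) by apply: sym_connect_sym; exact: adj_sym.
move=> cG.
have old u v : connect (@adj H) (inl u) (inl v).
  have /connectP[p pth ->] := cG u v.
  elim: p u pth => [|z p IH] u //= /andP[uz /IH].
  by apply: connect_trans; exact: (@connect1 _ (@adj H)).
have near x : exists u, connect (@adj H) x (inl u).
  case: x => [u|[[d i] b]]; first by exists u.
  exists (val d).1.
  have c0 : connect (@adj H) (inr (d, i, false)) (inl (val d).1).
    by apply: connect1; rewrite /= eqxx.
  case: b => //; apply: connect_trans c0.
  by apply: connect1; rewrite /= !eqxx.
move=> x y; have [u xu] := near x; have [v yv] := near y.
by apply: connect_trans xu (connect_trans (old u v) _); rewrite sH.
Qed.

(** * A Green kernel of the hexagonal graph *)

(** The position on its path of the vertex (d, i, b), as a fraction of the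
    length of the path, measured from the source of d. *)
Definition pos b : R := if b then 2 / 5 else 1 / 5.

Definition interp f x : R :=
  match x with
  | inl u => f u
  | inr (d, _, b) => (1 - pos b) * f (val d).1 + pos b * f (val d).2
  end.

(** The inverse of the Laplacian of the path interiors: on a path of length 5
    with grounded ends it is 5 s (1 - t) for positions s <= t.  The second
    summand is the case of two points that are closest to opposite ends: seen
    from the source of d, the vertex y lies at 1 - pos b', which is beyond x. *)
Definition path_green x y : R :=
  match x, y with
  | inr (d, i, b), inr (d', i', b') =>
      (i == i')%:R *
      ((d == d')%:R * (5 * pos (b && b') * (1 - pos (b || b')))
       + (drev d == d')%:R * (5 * pos b * pos b'))
  | _, _ => 0
  end.

Lemma interp_scale c f x : interp (fun a => c * f a) x = c * interp f x.
Proof. by case: x => [u|[[d i] b]] //=; ring. Qed.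

Lemma interp_sub f h x : interp (fun a => f a - h a) x = interp f x - interp h x.
Proof. by case: x => [u|[[d i] b]] //=; ring. Qed.

Lemma interp_const c x : interp (fun=> c) x = c.
Proof. by case: x => [u|[[d i] b]] //=; ring. Qed.

Lemma interp_sum (I : finType) (P : pred I) (F : I -> G -> R) x :
  interp (fun a => \sum_(j | P j) F j a) x = \sum_(j | P j) interp (F j) x.
Proof. by case: x => [u|[[d i] b]] //=; rewrite !mulr_sumr -big_split. Qed.

Lemma eq_interp f h x : f =1 h -> interp f x = interp h x.
Proof. by move=> fh; case: x => [u|[[d i] b]] /=; rewrite ?fh. Qed.

(** The potential drop on the first edge of a path is a fifth of the drop
    between the ends, so the k paths add k/5 to the conductance of an edge. *)
Lemma laplacian_interp_old f (a : G) :
  \sum_(z | @adj H (inl a) z) (interp f (inl a) - interp f z)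
  = (K + 5) / 5 * \sum_(v | adj a v) (f a - f v).
Proof.
rewrite sum_adj_old /=.
rewrite (eq_bigr (fun d => K / 5 * (f a - f (val d).2))); last first.
  move=> d /eqP <-; rewrite sum_ord_const /pos.
  by field.
rewrite (sum_dart_from a (fun v => K / 5 * (f a - f v))) -mulr_sumr.
by field.
Qed.

Lemma laplacian_interp_new f d i b :
  \sum_(z | @adj H (inr (d, i, b)) z) (interp f (inr (d, i, b)) - interp f z)
  = 0.
Proof. by rewrite sum_adj_new /pos; case: b => /=; rewrite /pos; field. Qed.

Lemma drev_eq d d' : (drev d == d') = (d == drev d').
Proof. by rewrite -(inv_eq (@drevK G)) eq_sym [LHS]eq_sym. Qed.

Lemma laplacian_path_new d i b y :
  \sum_(z | @adj H (inr (d, i, b)) z) (path_green (inr (d, i, b)) y - path_green z y)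
  = (inr (d, i, b) == y)%:R.
Proof.
rewrite sum_adj_new; case: y => [u|[[d' i'] b']] /=.
  by case: b => /=; rewrite !subr0 addr0.
rewrite inr_eq !xpair_eqE drevK.
have nd := drev_neq d.
case: (i == i'); last by case: b; rewrite !mul0r ?andbF /= ?subr0 ?addr0.
have [dd|dd] := eqVneq d d'.
  rewrite -dd (negbTE nd) /=.
  by case: b; case: b' => /=; rewrite /pos /=; field.
by case: (drev d == d'); case: b; case: b' => /=; rewrite /pos /=; field.
Qed.

(** When y is on a path, the unit current injected there leaves at the two
    ends in the proportions of the interpolation weights of y. *)
Lemma laplacian_path_old (a : G) y :
  \sum_(z | @adj H (inl a) z) (path_green (inl a) y - path_green z y)
  = (inl a == y :> H)%:R - interp (fun u => (a == u)%:R) y.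
Proof.
rewrite sum_adj_old big1 ?add0r; last by move=> v _ /=; rewrite subr0.
case: y => [u|[[d' i'] b']] /=.
  rewrite big1; first by rewrite inl_eq subrr.
  by move=> d _; apply: big1 => i _; rewrite subr0.
transitivity (\sum_(d | a == (val d).1)
    ((d == d')%:R * (pos b' - 1) - (drev d == d')%:R * pos b')).
  apply: eq_bigr => d _; rewrite (bigD1 i') //= eqxx big1 ?addr0; last first.
    by move=> i /negbTE ->; rewrite mul0r subrr.
  by case: b' => /=; rewrite /pos /=; field.
rewrite sumrB.
have pick d0 (c : R) :
    \sum_(d | a == (val d).1) (d == d0)%:R * c = (a == (val d0).1)%:R * c.
  rewrite big_mkcond (bigD1 d0) //= eqxx big1 ?addr0; last first.
    by move=> d /negbTE ->; case: ifP; rewrite ?mul0r.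
  by case: (a == _); rewrite ?mul1r ?mul0r.
under [X in _ - X]eq_bigr do rewrite drev_eq.
by rewrite !pick //=; ring.
Qed.

Definition hex_green (g : G -> G -> R) x y : R :=
  5 / (K + 5) * interp (fun a => interp (g a) y) x + path_green x y.

(** The defects of the two parts cancel at an old vertex a: interpolating the
    source of the current gives the weight of y at a, while the grounded paths
    give minus that weight, plus the required unit source. *)
Lemma hex_greenP (o : G) g :
  green_kernel o g -> @green_kernel R H (inl o) (hex_green g).
Proof.
have K5 : K + 5 != 0 by rewrite -natrD pnatr_eq0 addn_eq0 andbF.
move=> gP y w; rewrite /hex_green.
pose h a := interp (g a) y.
rewrite (eq_bigr (fun z => 5 / (K + 5) * (interp h w - interp h z)
   + (path_green w y - path_green z y))); last by move=> z _; ring.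
rewrite big_split /= -mulr_sumr.
case: w => [a|[[d i] b]]; last first.
  by rewrite laplacian_interp_new laplacian_path_new mulr0 add0r subr0.
rewrite laplacian_interp_old laplacian_path_old.
have -> : \sum_(v | adj a v) (h a - h v)
  = interp (fun u => (a == u)%:R) y - (a == o)%:R.
  rewrite -[X in _ - X](interp_const _ y) -interp_sub.
  under eq_bigr do rewrite -interp_sub.
  rewrite -interp_sum; apply: eq_interp => u; exact: gP.
rewrite inl_eq.
by field.
Qed.

(** * Degree-weighted sums over the hexagonal graph *)

Lemma sum_deg_hex (F : H -> R) :
  \sum_x (deg x)%:R * F x = (K + 1) * (\sum_u (deg u)%:R * F (inl u))
    + 2 * \sum_d \sum_i (F (inr (d, i, false)) + F (inr (d, i, true))).
Proof.
rewrite sum_hex; congr (_ + _).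
  by rewrite mulr_sumr; apply: eq_bigr => u _; rewrite deg_hex_old mulrA.
rewrite mulr_sumr; apply: eq_bigr => d _.
rewrite mulr_sumr; apply: eq_bigr => i _.
by rewrite !deg_hex_new mulrDr.
Qed.

(** An old vertex u weighs (k + 1) deg u itself, and receives from each of the
    k paths at each of its edges 2 (4/5 + 3/5 + 2/5 + 1/5) = 4. *)
Lemma sum_deg_interp f :
  \sum_x (deg x)%:R * interp f x = (5 * K + 1) * \sum_u (deg u)%:R * f u.
Proof.
rewrite sum_deg_hex /=.
under [X in _ + _ * X]eq_bigr do rewrite sum_ord_const.
(* On the half path next to d.1, the source gets 4/5 + 3/5 and the target gets
   1/5 + 2/5; the target is the source of drev d. *)
rewrite (eq_bigr (fun d => K * (7 / 5 * f (val d).1 + 3 / 5 * f (val (drev d)).1))).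
  rewrite -mulr_sumr big_split /= -!mulr_sumr.
  rewrite (sum_dart_rev (fun d => f (val d).1)) sum_deg_dart.
  by field.
by move=> d _; rewrite /pos; field.
Qed.

(** The handshake lemma on both graphs, linked by the constant function 1. *)
Lemma edges_hex : #|edges H|%:R = (5 * K + 1) * #|edges G|%:R :> R.
Proof.
have := sum_deg_interp (fun=> 1).
under eq_bigr do rewrite interp_const mulr1.
under [X in _ = _ * X]eq_bigr do rewrite mulr1.
by rewrite !sum_deg; lra.
Qed.

Lemma card_hex : #|H|%:R = #|G|%:R + 4 * K * #|edges G|%:R :> R.
Proof.
rewrite card_sum !card_prod card_ord card_bool card_dart natrD !natrM.
by congr (_ + _); ring.
Qed.

(** At position s the two interpolations give (1-s)^2 g(u,u) + s^2 g(v,v)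
    + s(1-s) (g(u,v) + g(v,u)), which is the interpolated diagonal minus
    s(1-s) times the resistance across uv.  The factor 4k/5 is
    2k (4/25 + 6/25), from the degree 2 and the positions 1/5 and 2/5. *)
Lemma sum_interp_diag (g : G -> G -> R) :
  \sum_x (deg x)%:R * interp (fun a => interp (g a) x) x
  = (5 * K + 1) * \sum_u (deg u)%:R * g u u
    - 4 * K / 5 * \sum_(d : dart G) (g (val d).1 (val d).1 - g (val d).1 (val d).2
          - g (val d).2 (val d).1 + g (val d).2 (val d).2).
Proof.
rewrite -(sum_deg_interp (fun u => g u u)) !sum_deg_hex /= -addrA; congr (_ + _).
rewrite [LHS]mulr_sumr [X in _ = X - _]mulr_sumr [X in _ = _ - X]mulr_sumr.
rewrite -sumrB; apply: eq_bigr => d _.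
by rewrite !sum_ord_const /pos; field.
Qed.

Lemma sum_path_green_diag :
  \sum_x (deg x)%:R * path_green x x = 8 * K * #|edges G|%:R.
Proof.
rewrite sum_deg_hex big1 /=; last by move=> u _; rewrite mulr0.
(* The two diagonal values on a half path are 4/5 and 6/5, whose sum is 2. *)
rewrite (eq_bigr (fun=> 2 * K)); last first.
  move=> d _; rewrite (eq_bigr (fun=> 2)); first by rewrite sum_ord_const mulrC.
  by move=> i _; rewrite !eqxx (negbTE (drev_neq d)) /pos /=; field.
rewrite sumr_const card_dart -[X in 2 * X]mulr_natl natrM; ring.
Qed.

Lemma sum_delta (I : finType) (c : I) (F : I -> R) :
  \sum_j (c == j)%:R * F j = F c.
Proof.
rewrite (bigD1 c) //= eqxx mul1r big1 ?addr0 // => j jc.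
by rewrite eq_sym (negbTE jc) mul0r.
Qed.

(** As all degrees on a path are 2, this solves the discrete Poisson equation
    with constant source 2: the value is t (5 - t) at distance t from an end. *)
Lemma sum_path_green x :
  \sum_y (deg y)%:R * path_green x y
  = match x with inl _ => 0 | inr (_, _, b) => if b then 6 else 4 end.
Proof.
rewrite sum_deg_hex.
case: x => [u|[[d i] b]] /=.
  rewrite [X in _ + _ * X]big1; last by move=> d _; apply: big1 => i _; rewrite addr0.
  by rewrite mulr0 addr0 big1 ?mulr0 // => u' _; rewrite mulr0.
rewrite big1 ?mulr0 ?add0r; last by move=> u _; rewrite mulr0.
rewrite (eq_bigr (fun d' => (d == d')%:R * (if b then 9 / 5 else 7 / 5)
                          + (drev d == d')%:R * (3 * pos b))); last first.
  move=> d' _; rewrite -[RHS](sum_delta i (fun=> _)).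
  by apply: eq_bigr => i' _; rewrite -mulrDr; case: b; rewrite /pos /=; field.
by rewrite big_split /= !sum_delta /pos; case: b; field.
Qed.

Lemma sum_path_green2 :
  \sum_x (deg x)%:R * \sum_y (deg y)%:R * path_green x y = 40 * K * #|edges G|%:R.
Proof.
under eq_bigr do rewrite sum_path_green.
rewrite sum_deg_hex big1; last by move=> u _; rewrite mulr0.
under [X in _ + _ * X]eq_bigr do rewrite sum_ord_const.
by rewrite sumr_const card_dart -[X in 2 * X]mulr_natl natrM; ring.
Qed.

Lemma mult_degree_Kirchhoff_hex (o : G) : connected G ->
  mult_degree_Kirchhoff R H =
    5 * (5 * K + 1) ^+ 2 / (K + 5) * mult_degree_Kirchhoff R G
    - 16 * K * (5 * K + 1) / (K + 5) * #|edges G|%:R * (#|G|%:R - 1)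
    + 16 * K * (5 * K + 1) * #|edges G|%:R ^+ 2
    - 40 * K * #|edges G|%:R.
Proof.
move=> cG; have [g gP] := green_kernel_exists R o cG.
have K5 : K + 5 != 0 by rewrite -natrD pnatr_eq0 addn_eq0 andbF.
rewrite (mult_degree_Kirchhoff_green gP cG).
rewrite (mult_degree_Kirchhoff_green (hex_greenP gP) (connected_hex cG)).
rewrite edges_hex.
have -> : \sum_x (deg x)%:R * hex_green g x x
  = 5 / (K + 5) * ((5 * K + 1) * (\sum_u (deg u)%:R * g u u)
      - 4 * K / 5 * (2 * (#|G|%:R - 1))) + 8 * K * #|edges G|%:R.
  rewrite -(foster gP cG) -sum_path_green_diag.
  under [X in _ - _ * X]eq_bigr do rewrite (resistance_green gP) //.
  rewrite -sum_interp_diag mulr_sumr -big_split /=.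
  by apply: eq_bigr => x _; rewrite /hex_green; ring.
have -> : \sum_x (deg x)%:R * (\sum_y (deg y)%:R * hex_green g x y)
  = 5 / (K + 5) * ((5 * K + 1) ^+ 2
      * \sum_u (deg u)%:R * \sum_v (deg v)%:R * g u v)
    + 40 * K * #|edges G|%:R.
  rewrite -sum_path_green2 expr2 -(mulrA (5 * K + 1)) -sum_deg_interp.
  rewrite !mulr_sumr -big_split /=; apply: eq_bigr => x _.
  suff -> : \sum_y (deg y)%:R * hex_green g x y
    = 5 / (K + 5) * ((5 * K + 1) * interp (fun u => \sum_v (deg v)%:R * g u v) x)
      + \sum_y (deg y)%:R * path_green x y by ring.
  rewrite -interp_scale.
  rewrite -(eq_interp _ (fun a => sum_deg_interp (g a))) interp_sum.
  rewrite mulr_sumr -big_split /=; apply: eq_bigr => y _.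
  by rewrite interp_scale /hex_green; ring.
by field.
Qed.

End Hex.

(** * Iterating the construction *)

Section Iteration.
Variables (R : realFieldType) (k : nat) (G : sgraph).
Local Notation K := (k%:R : R).

Lemma connected_hexn m : connected G -> connected (hexn k m G).
Proof. by move=> cG; elim: m => //= m; exact: connected_hex. Qed.

Lemma edges_hexn m :
  #|edges (hexn k m G)|%:R = (5 * K + 1) ^+ m * #|edges G|%:R :> R.
Proof.
elim: m => [|m IH]; first by rewrite mul1r.
by rewrite /hexn iterS edges_hex IH exprS mulrA.
Qed.

Lemma card_hexn m :
  #|hexn k m G|%:R
  = #|G|%:R + 4 / 5 * ((5 * K + 1) ^+ m - 1) * #|edges G|%:R :> R.
Proof.
elim: m => [|m IH]; first by rewrite subrr mulr0 mul0r addr0.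
by rewrite /hexn iterS card_hex IH edges_hexn exprS; field.
Qed.

End Iteration.

Lemma geometric_recurrence (F : fieldType) (a b c q : F) (x : nat -> F) :
  a - q != 0 -> a - q ^+ 2 != 0 ->
  (forall m, x m.+1 = a * x m + b * q ^+ m + c * (q ^+ m) ^+ 2) ->
  forall m, x m = a ^+ m * x 0%N + b * ((a ^+ m - q ^+ m) / (a - q))
                  + c * ((a ^+ m - (q ^+ m) ^+ 2) / (a - q ^+ 2)).
Proof.
move=> aq aqq rec; elim=> [|m IH].
  by rewrite expr1n !subrr !mul0r !mulr0 !addr0 mul1r.
by rewrite rec IH !(exprS _ m); field; rewrite aqq aq.
Qed.

Theorem theorem3p5 (R : realFieldType) (G : sgraph) (k n : nat)
    (hG : connected G) (hE : (1 <= #|edges G|)%N)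
    (hk : (2 <= k)%N) (hn : (1 <= n)%N) :
  let Kf' (F : sgraph) : R := mult_degree_Kirchhoff R F in
  let N0 : R := #|G|%:R in
  let E0 : R := #|edges G|%:R in
  let K : R := k%:R in
  let mu : R :=
    (K + 5) / (24 * K) * (((5 * (5 * K + 1)) / (K + 5)) ^+ n - 1) in
  let eta : R :=
    - ((K + 5) / K) * ((5 / (K + 5)) ^+ n - 1) in
  Kf' (hexn k n G) =
      5 * (5 * K + 1) ^+ 2 / (K + 5) * Kf' (hexn k (n - 1) G)
      - 16 * K * (5 * K + 1) ^+ n / (K + 5) * E0 * N0
      + (64 * K / (5 * (K + 5)) * (5 * K + 1) ^+ n
         + 16 * K * (5 * K + 21) / (5 * (K + 5)) * (5 * K + 1) ^+ (2 * n - 1))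
        * E0 ^+ 2
      + 8 * (5 * K ^+ 2 - 23 * K) / (K + 5) * (5 * K + 1) ^+ (n - 1) * E0
  /\
  Kf' (hexn k n G) =
      (5 * (5 * K + 1) ^+ 2 / (K + 5)) ^+ n * Kf' G
      - 16 * K * (5 * K + 1) ^+ n * mu / (K + 5) * E0 * N0
      + (64 * K * mu / (5 * (K + 5)) * (5 * K + 1) ^+ n
         + 16 * K * (5 * K + 21) * eta / (5 * (K + 5))
           * (5 * K + 1) ^+ (2 * n - 1))
        * E0 ^+ 2
      + 8 * (5 * K ^+ 2 - 23 * K) * mu / (K + 5) * (5 * K + 1) ^+ (n - 1) * E0.
Proof.
move=> Kf' N0 E0 K mu eta.
have [o _] : exists o : G, True.
  by have /card_gt0P[_ /imsetP[[o _] _ _]] := hE; exists o.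
have om m : hexn k m G by elim: m => [|m om]; [exact: o | exact: inl om].
have K_gt0 : 0 < K by rewrite ltr0n (leq_trans _ hk).
have K0 : K != 0 by rewrite gt_eqF.
have K5 : K + 5 != 0 by apply/eqP; lra.
have q0 : 5 * K + 1 != 0 by apply/eqP; lra.
(* The one-step formula with N and E at stage m expressed through q ^+ m. *)
have step m : Kf' (hexn k m.+1 G)
    = 5 * (5 * K + 1) ^+ 2 / (K + 5) * Kf' (hexn k m G)
      + (- (16 * K * (5 * K + 1) / (K + 5) * E0 * (N0 - 4 / 5 * E0 - 1))
         - 40 * K * E0) * (5 * K + 1) ^+ m
      + 16 * K * (5 * K + 1) * (5 * K + 21) / (5 * (K + 5)) * E0 ^+ 2
         * ((5 * K + 1) ^+ m) ^+ 2.
  rewrite /Kf' /hexn iterS.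
  rewrite (mult_degree_Kirchhoff_hex R k (om m) (connected_hexn (m := m) hG)).
  by rewrite edges_hexn card_hexn -/K -/E0 -/N0; field.
have E2 m : (2 * m.+1 - 1 = m + m + 1)%N.
  by rewrite mulnS mul2n -addnn addnC addn2 subn1 addn1.
split.
  case: n hn @mu @eta => [//|m] _ mu eta.
  rewrite E2 subn1 /= step !exprD (exprS _ m) expr1.
  by field.
have aq : 5 * (5 * K + 1) ^+ 2 / (K + 5) - (5 * K + 1)
    = 24 * K * (5 * K + 1) / (K + 5) by field.
have aqq : 5 * (5 * K + 1) ^+ 2 / (K + 5) - (5 * K + 1) ^+ 2
    = - (K * (5 * K + 1) ^+ 2 / (K + 5)) by field.
have aq0 : 24 * K * (5 * K + 1) / (K + 5) != 0.
  by rewrite !mulf_eq0 invr_eq0 !negb_or pnatr_eq0 K0 K5 q0.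
have aqq0 : - (K * (5 * K + 1) ^+ 2 / (K + 5)) != 0.
  by rewrite oppr_eq0 expr2 !mulf_eq0 invr_eq0 !negb_or K0 K5 q0.
rewrite (geometric_recurrence (x := fun m => Kf' (hexn k m G)) _ _ step) ?aq ?aqq //=.
(* With q = 5K + 1, all three growth rates are products of powers of q and of
   5 / (K + 5), which makes the closed form a rational identity. *)
rewrite /mu /eta.
have -> : (5 * (5 * K + 1) ^+ 2 / (K + 5)) ^+ n
    = (5 / (K + 5)) ^+ n * ((5 * K + 1) ^+ n) ^+ 2.
  by rewrite exprAC -exprMn mulrAC.
have -> : (5 * (5 * K + 1) / (K + 5)) ^+ n = (5 / (K + 5)) ^+ n * (5 * K + 1) ^+ n.
  by rewrite -exprMn mulrAC.
move: ((5 / (K + 5)) ^+ n) => T.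
case: n hn @mu @eta => [//|m] _ _ _.
rewrite E2 subn1 /= !exprD (exprS _ m) expr1.
move: ((5 * K + 1) ^+ m) => Q.
by field; rewrite K0 K5 q0.
Qed.
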